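(* Let $\overline\Theta>\Theta$ and $\beta>\overline\Theta-\Theta$. Let $$\alpha:=2nc(\overline\Theta-\Theta)\in(0,+\infty)\qquad\text{and}\qquad t_\star:=\frac{\beta-\overline\Theta+\Theta}{\alpha}.$$ Let $u$ be a solution of $$\partial_t u(x,t)=c\Delta u(x,t)+\int_{B_1}\big(u(y,t)-\Theta\big)_+\,K(x,y)\,dy\qquad\text{in }B_1\times(0,+\infty),$$ with $u(x,t)=\overline\Theta$ for all $x\in\partial B_1$ and $t\in[0,+\infty)$. Suppose that $$u(x,0)\ge\overline\Theta-\beta(1-|x|^2)\qquad\text{for all }x\in B_1.$$ Then, for all $x\in B_1$, $$u(x,t_\star)\ge\Theta.$$ More precisely, for all $x\in B_1$ and $t\in[0,t_\star]$, $$u(x,t)\ge\overline\Theta-(\beta-\alpha t)(1-|x|^2).$$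
   Context: $B_1\subset\mathbb{R}^n$ is the open unit ball centered at the origin, $c\in(0,+\infty)$, $\Theta,\overline\Theta,\beta\in\mathbb{R}$, and $r_+:=\max\{r,0\}$ for $r\in\mathbb{R}$. The Laplacian $\Delta$ acts in the space variable $x$. The kernel $K:B_1\times B_1\to[0,+\infty)$ is measurable, nonnegative and integrable, with $\sup_{x\in B_1}\int_{B_1}K(x,y)\,dy<+\infty$. Solutions are classical: $u:\overline{B_1}\times[0,+\infty)\to\mathbb{R}$ is continuous, for every $x\in B_1$ the map $(0,+\infty)\ni t\mapsto u(x,t)$ is continuously differentiable, and for every $t\in(0,+\infty)$ the map $B_1\ni x\mapsto u(x,t)$ is twice continuously differentiable. *)

(* Defs.v *)
From HB Require Import structures.
From mathcomp Require Export all_boot all_order all_algebra.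
From mathcomp Require Export all_classical all_reals all_analysis.
Export Order.TTheory GRing.Theory Num.Def Num.Theory.
Export numFieldNormedType.Exports.

#[export] Set Implicit Arguments.
#[export] Unset Strict Implicit.
#[export] Unset Printing Implicit Defensive.

#[global] Open Scope classical_set_scope.
#[global] Open Scope ring_scope.

(* R^n is 'rV[R]_n: its library topology is the usual one, but its library
   norm `|x| is the sup norm, so the Euclidean norm is introduced here. *)
Definition enorm (R : realType) (n : nat) (x : 'rV[R]_n) : R :=
  Num.sqrt (\sum_(i < n) x ord0 i ^+ 2).

Definition unit_ball (R : realType) (n : nat) : set 'rV[R]_n :=
  [set x | enorm x < 1].

Definition unit_cball (R : realType) (n : nat) : set 'rV[R]_n :=
  [set x | enorm x <= 1].

Definition unit_sphere (R : realType) (n : nat) : set 'rV[R]_n :=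
  [set x | enorm x = 1].

Arguments unit_ball : clear implicits.
Arguments unit_cball : clear implicits.
Arguments unit_sphere : clear implicits.

(* Borel sets of R^n: the sigma-algebra generated by the coordinate maps. *)
Section borel_rV.
Variables (R : realType) (n : nat).

Definition rV_coord (i : 'I_n) (x : 'rV[R]_n) : measurableTypeR R := x ord0 i.

Let rV_borel := g_sigma_preimage rV_coord.

Let rV_borel0 : rV_borel set0.
Proof. exact: sigma_algebra0. Qed.

Let rV_borelC A : rV_borel A -> rV_borel (~` A).
Proof. exact: sigma_algebraC. Qed.

Let rV_borel_bigcup (F : (set 'rV[R]_n)^nat) : (forall i, rV_borel (F i)) ->
  rV_borel (\bigcup_i (F i)).
Proof. exact: sigma_algebra_bigcup. Qed.

HB.instance Definition _ := @isMeasurable.Build default_measure_display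
  'rV[R]_n rV_borel rV_borel0 rV_borelC rV_borel_bigcup.

Lemma measurable_rV_coord (i : 'I_n) : measurable_fun setT (rV_coord i).
Proof.
move=> _ Y mY; rewrite setTI; apply: sub_sigma_algebra => /=.
rewrite -bigcup_seq/=; exists i => /=; first by rewrite mem_index_enum.
by exists Y => //; rewrite setTI.
Qed.

Lemma measurable_fun_rVP d (T : measurableType d) (f : T -> 'rV[R]_n) :
  (forall i, measurable_fun setT (rV_coord i \o f)) -> measurable_fun setT f.
Proof.
move=> mf; apply: (@measurability _ _ _ _ _ _
  (\big[setU/set0]_(i < n) preimage_set_system setT (rV_coord i) measurable)) => //.
move=> _ [A + <-]; rewrite -bigcup_seq/= => -[i _ [Y mY <-]].
by rewrite setTI setTI -comp_preimage -[X in measurable X]setTI; exact: mf.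
Qed.

End borel_rV.

Definition rV_cons (R : realType) (n : nat) (p : measurableTypeR R * 'rV[R]_n) :
    'rV[R]_(1 + n) :=
  row_mx (const_mx (p.1 : R)) p.2.

Lemma measurable_rV_cons (R : realType) (n : nat) :
  measurable_fun setT (@rV_cons R n).
Proof.
apply: measurable_fun_rVP => i.
case: (split_ordP i) => j ->.
  rewrite (_ : _ \o _ = fst); first exact: measurable_fst.
  by apply/funext => p; rewrite /= /rV_coord row_mxEl mxE.
rewrite (_ : _ \o _ = rV_coord j \o snd).
  by apply: measurableT_comp; [exact: measurable_rV_coord|exact: measurable_snd].
by apply/funext => p; rewrite /= /rV_coord row_mxEr.
Qed.

Section rV_cons_measure.
Local Open Scope ereal_scope.
Variables (R : realType) (n : nat).
Variable mu : {sigma_finite_measure set 'rV[R]_n -> \bar R}.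

Definition rV_cons_measure : set 'rV[R]_n.+1 -> \bar R :=
  pushforward (lebesgue_measure \x mu) (@rV_cons R n).

Let preim_cons (A : set 'rV[R]_n.+1) :
  measurable A -> measurable (@rV_cons R n @^-1` A).
Proof.
by move=> mA; rewrite -[X in measurable X]setTI; exact: measurable_rV_cons.
Qed.

Let rV_cons_measure0 : rV_cons_measure set0 = 0.
Proof. by rewrite /rV_cons_measure /pushforward preimage_set0 measure0. Qed.

Let rV_cons_measure_ge0 A : 0 <= rV_cons_measure A.
Proof. by rewrite /rV_cons_measure /pushforward measure_ge0. Qed.

Let rV_cons_measure_sigma_additive : semi_sigma_additive rV_cons_measure.
Proof.
move=> F mF tF mUF; rewrite /rV_cons_measure /pushforward preimage_bigcup.
apply: measure_semi_sigma_additive.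
- by move=> i; exact: preim_cons.
- apply/trivIsetP => /= i j _ _ ij; rewrite -preimage_setI.
  by move/trivIsetP : tF => /(_ _ _ _ _ ij) ->//; rewrite preimage_set0.
- by rewrite -preimage_bigcup; exact: preim_cons.
Qed.

HB.instance Definition _ := isMeasure.Build _ _ _ rV_cons_measure
  rV_cons_measure0 rV_cons_measure_ge0 rV_cons_measure_sigma_additive.

Let rV_tl (x : 'rV[R]_n.+1) : measurableTypeR R * 'rV[R]_n :=
  (x ord0 ord0, @rsubmx R 1 1 n x).

Let rV_tlK : cancel (@rV_cons R n) rV_tl.
Proof.
move=> [a x]; rewrite /rV_tl /rV_cons row_mxKr; congr (_, _) => /=.
have -> : (ord0 : 'I_n.+1) = lshift n (ord0 : 'I_1) by apply/val_inj.
by apply: etrans; [exact: row_mxEl|exact: mxE].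
Qed.

Let measurable_rV_tl : measurable_fun setT rV_tl.
Proof.
apply: measurable_fun_pair; first exact: (measurable_rV_coord (ord0 : 'I_n.+1)).
apply: measurable_fun_rVP => i.
rewrite (_ : _ \o _ = rV_coord (rshift 1 i : 'I_n.+1)).
  exact: measurable_rV_coord.
by apply/funext => x; rewrite /= /rV_coord mxE.
Qed.

Let rV_cons_measure_sigma_finite : sigma_finite setT rV_cons_measure.
Proof.
have /sigma_finiteP[F [FT ndF Foo]] := sigma_finiteT (@lebesgue_measure R).
have /sigma_finiteP[G [GT ndG Goo]] := sigma_finiteT mu.
exists (fun k => rV_tl @^-1` (F k `*` G k)).
  rewrite -preimage_bigcup (_ : \bigcup_k (F k `*` G k) = setT)//.
  apply/seteqP; split=> // -[x y] _.
  have [i _ Fix] : (\bigcup_i F i) x by rewrite -FT.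
  have [j _ Gjy] : (\bigcup_i G i) y by rewrite -GT.
  exists (maxn i j) => //; split.
    by move: x Fix; exact/subsetPset/ndF/leq_maxl.
  by move: y Gjy; exact/subsetPset/ndG/leq_maxr.
move=> k; have [mF Fk] := Foo k; have [mG Gk] := Goo k; split.
  by rewrite -[X in measurable X]setTI; apply: measurable_rV_tl => //; exact: measurableX.
rewrite /rV_cons_measure /pushforward -comp_preimage.
rewrite (_ : rV_tl \o _ = id); last by apply/funext => p; exact: rV_tlK.
by rewrite preimage_id product_measure1E// lte_mul_pinfty// ge0_fin_numE.
Qed.

HB.instance Definition _ := Measure_isSigmaFinite.Build _ _ _ rV_cons_measure
  rV_cons_measure_sigma_finite.

End rV_cons_measure.

(* The n-dimensional product of the library's one-dimensional Lebesgue measure,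
   on Borel sets; R^(n+1) is seen as R x R^n. *)
Fixpoint borel_lebesgue (R : realType) (n : nat) :
    {sigma_finite_measure set 'rV[R]_n -> \bar R} :=
  match n with
  | 0%N => (\d_(0 : 'rV[R]_0) : {sigma_finite_measure set _ -> \bar R})
  | m.+1 => (rV_cons_measure (borel_lebesgue R m)
             : {sigma_finite_measure set _ -> \bar R})
  end.

Definition box (R : realType) (n : nat) (a b : 'rV[R]_n) : set 'rV[R]_n :=
  [set x | forall i, a ord0 i <= x ord0 i <= b ord0 i].

Lemma measurable_box (R : realType) (n : nat) (a b : 'rV[R]_n) :
  measurable (box a b).
Proof.
rewrite (_ : box a b = \big[setI/setT]_(i < n)
    (rV_coord i @^-1` `[a ord0 i, b ord0 i])); last first.
  rewrite -bigcap_seq/=; apply/seteqP; split=> x /= xab.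
    by move=> i _; rewrite /= in_itv/=; exact: xab.
  by move=> i; have := xab i (mem_index_enum i); rewrite /= in_itv.
apply: bigsetI_measurable => i _; rewrite -[X in measurable X]setTI.
by apply: measurable_rV_coord => //; exact: measurable_itv.
Qed.

Lemma borel_lebesgue_box (R : realType) (n : nat) (a b : 'rV[R]_n) :
  (forall i, a ord0 i <= b ord0 i) ->
  borel_lebesgue R n (box a b) = (\prod_(i < n) (b ord0 i - a ord0 i))%:E.
Proof.
elim: n a b => [|n IH] a b ab.
  by rewrite big_ord0 /= diracE mem_set// => -[].
pose tl (x : 'rV[R]_n.+1) : 'rV[R]_n := @rsubmx R 1 1 n x.
have tlE x i : tl x ord0 i = x ord0 (lift ord0 i).
  by rewrite mxE; congr (x _ _); apply/val_inj.
have boxE : @rV_cons R n @^-1` box a b =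
    `[a ord0 ord0, b ord0 ord0] `*` box (tl a) (tl b).
  have hd (p : measurableTypeR R * 'rV[R]_n) :
      (rV_cons p : 'rV[R]_n.+1) ord0 ord0 = p.1.
    have -> : (ord0 : 'I_n.+1) = lshift n (ord0 : 'I_1) by apply/val_inj.
    by apply: etrans; [exact: row_mxEl|exact: mxE].
  have tlp (p : measurableTypeR R * 'rV[R]_n) i :
      (rV_cons p : 'rV[R]_n.+1) ord0 (lift ord0 i) = p.2 ord0 i.
    have -> : lift ord0 i = rshift 1 i :> 'I_n.+1 by apply/val_inj.
    exact: row_mxEr.
  apply/seteqP; split=> p.
    move=> pab; split=> /=.
      by have := pab ord0; rewrite hd in_itv.
    by move=> i; have := pab (lift ord0 i); rewrite tlp !tlE.
  move=> [p1 p2] i; case: (unliftP ord0 i) => [j|] ->.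
    by have := p2 j; rewrite tlp !tlE.
  by move: p1; rewrite hd /= in_itv.
rewrite /= /rV_cons_measure /pushforward boxE product_measure1E//; last first.
  exact: measurable_box.
rewrite IH; last by move=> i; rewrite !tlE.
rewrite big_ord_recl EFinM; congr (_ * _)%E.
  apply: etrans; first exact: lebesgue_measure_itv.
  rewrite /= lte_fin; case: ltP => // ba; suff -> : a ord0 ord0 = b ord0 ord0 by rewrite subrr.
  by apply/eqP; rewrite eq_le ab ba.
by congr EFin; apply: eq_bigr => i _; rewrite !tlE.
Qed.

(* Lebesgue measure on R^n and on R^n x R^n, on Lebesgue measurable sets:
   completions of the product measures on Borel sets. *)
Definition lebesgue (R : realType) (n : nat) :=
  @completed_measure_extension _ _ _ (borel_lebesgue R n).
HB.instance Definition _ (R : realType) (n : nat) :=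
  Measure.on (@lebesgue R n).

Definition lebesgue2 (R : realType) (n : nat) :=
  @completed_measure_extension _ _ _
    (borel_lebesgue R n \x borel_lebesgue R n)%E.
HB.instance Definition _ (R : realType) (n : nat) :=
  Measure.on (@lebesgue2 R n).

Arguments lebesgue : clear implicits.
Arguments lebesgue2 : clear implicits.

Definition partial (R : realType) (n : nat) (i : 'I_n) (f : 'rV[R]_n -> R) :
    'rV[R]_n -> R :=
  'D_(delta_mx ord0 i) f.

Definition laplacian (R : realType) (n : nat) (f : 'rV[R]_n -> R) :
    'rV[R]_n -> R :=
  fun x => \sum_(i < n) partial i (partial i f) x.

(* C1_on and C2_on are meant for an open set D: derivatives at a point of D then
   depend only on the values of f on D. *)
Definition C1_on (R : realType) (D : set R) (f : R -> R) : Prop :=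
  forall t, D t -> derivable f t 1 /\ {for t, continuous (derive1 f)}.

Definition C2_on (R : realType) (n : nat) (D : set 'rV[R]_n)
    (f : 'rV[R]_n -> R) : Prop :=
  forall x, D x -> forall i,
    [/\ derivable f x (delta_mx ord0 i),
        {for x, continuous (partial i f)} &
        forall j, derivable (partial i f) x (delta_mx ord0 j) /\
          {for x, continuous (partial j (partial i f))}].

Definition classical (R : realType) (n : nat) (u : 'rV[R]_n -> R -> R) : Prop :=
  [/\ {within unit_cball R n `*` `[0, +oo[,
        continuous (fun p : 'rV[R]_n * R => u p.1 p.2)},
      forall x, unit_ball R n x -> C1_on `]0, +oo[ (u x) &
      forall t, 0 < t -> C2_on (unit_ball R n) (fun x => u x t)].

(* K represents a kernel on B_1 x B_1: only its values there matter. The integrability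
   of (x, y) |-> K x y includes its measurability; the measurability of each
   K x, which the integrals in the supremum presuppose, does not follow from it,
   as measurability is understood in the sense of Lebesgue. *)
Definition admissible_kernel (R : realType) (n : nat)
    (K : 'rV[R]_n -> 'rV[R]_n -> R) : Prop :=
  [/\ forall x y, unit_ball R n x -> unit_ball R n y -> 0 <= K x y,
      (lebesgue2 R n).-integrable (unit_ball R n `*` unit_ball R n)
        (fun p => (K p.1 p.2)%:E),
      forall x, unit_ball R n x ->
        measurable_fun
          (unit_ball R n : set (caratheodory_type ((borel_lebesgue R n)^*)%mu))
          (K x) &
      (ereal_sup [set \int[lebesgue R n]_(y in unit_ball R n) (K x y)%:E
                 | x in unit_ball R n] < +oo)%E].

(* Main.v *)
Require Import Defs.
From mathcomp Require Import ring lra.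

(** The nonlocal term of the equation is nonnegative, so [u] is a supersolution of
    the heat equation: [c * laplacian u <= d u / d t].  The function
      [v x t = Theta_bar - (beta - alpha * t) * (1 - |x|^2)]
    equals [Theta_bar] on the unit sphere, is at most [u] at time 0, and is a
    subsolution up to [t_star]: its time derivative [alpha * (1 - |x|^2)] is at
    most [alpha], while [c] times its Laplacian is
    [2 * n * c * (beta - alpha * t)], which is at least
    [alpha = 2 * n * c * (Theta_bar - Theta)] exactly as long as
    [beta - alpha * t >= Theta_bar - Theta], that is, as long as [t <= t_star].
    The weak minimum principle then gives [v <= u], and
    [v x t_star = Theta_bar - (Theta_bar - Theta) * (1 - |x|^2) >= Theta].

    The minimum principle is [paraboloid_barrier_le].  It rests on the first- and
    second-order conditions at a minimum of [u - v + e * t] over a compact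
    space-time cylinder: [derive1_le_left] bounds the time derivative, using
    earlier times only, and [laplacian_ge_touching_paraboloid] bounds the
    Laplacian by reduction to the one-dimensional second-derivative test
    [second_derivative_ge0_at_min] along coordinate lines. *)

Lemma enormE2 (R : realType) (n : nat) (x : 'rV[R]_n) :
  enorm x ^+ 2 = \sum_(i < n) x ord0 i ^+ 2.
Proof. by rewrite sqr_sqrtr// sumr_ge0// => i _; exact: sqr_ge0. Qed.

Lemma enorm_continuous (R : realType) (n : nat) :
  continuous (@enorm R n : 'rV[R]_n -> R).
Proof.
have sq_cont : continuous (fun x : 'rV[R]_n => \sum_(i < n) x ord0 i ^+ 2).
  apply: continuous_big => [|i _ x]; first exact: add_continuous.
  exact: (continuous_comp (@coord_continuous _ _ _ _ _ x) (@exprn_continuous _ 2 _)).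
by move=> x; exact: (continuous_comp (sq_cont x) (@sqrt_continuous _ _)).
Qed.

Lemma unit_ball_open (R : realType) (n : nat) : open (unit_ball R n).
Proof.
apply: (@open_comp _ _ (@enorm R n) [set r | r < 1]); last exact: open_lt.
by move=> x _; exact: enorm_continuous.
Qed.

Lemma coord_le_enorm (R : realType) (n : nat) (x : 'rV[R]_n) i :
  `|x ord0 i| <= enorm x.
Proof.
rewrite -sqrtr_sqr ler_sqrt ?sumr_ge0//; last by move=> j _; exact: sqr_ge0.
by rewrite (bigD1 i)//= lerDl sumr_ge0// => j _; exact: sqr_ge0.
Qed.

(** The library norm on row vectors is the sup norm, which is at most the
    Euclidean one, so the Euclidean ball is bounded for it. *)
Lemma unit_cball_compact (R : realType) (n : nat) : compact (unit_cball R n).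
Proof.
apply: bounded_closed_compact.
  exists 1; split=> // M M1 x xB.
  rewrite /= /normr/= mx_normrE; apply/bigmax_leP; split=> /=.
    by rewrite (le_trans _ (ltW M1)).
  move=> [i j] _ /=; rewrite ord1 (le_trans (coord_le_enorm _ _))//.
  exact: le_trans xB (ltW M1).
apply: (@preimage_closed _ _ (@enorm R n) [set r | r <= 1]).
  by move=> x _; exact: enorm_continuous.
exact: closed_le.
Qed.

(** Dividing by a negative increment reverses the inequality, so a line that
    stays below the graph on the left has a slope at least the derivative.
    Only the left side is available at the final time of a space-time cylinder,
    where a minimum may well occur. *)
Lemma derive1_le_left (R : realType) (f : R -> R) (t k : R) :
  derivable f t 1 -> (\forall h \near 0^'-, f t + k * h <= f (t + h)) ->
  derive1 f t <= k.
Proof.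
move=> df fk.
rewrite derive1E ['D_1 f t](cvg_at_leftE (fun h : R => h^-1 *: ((f \o shift t) _ - f t)))//.
apply: limr_le.
  rewrite -(cvg_at_leftE (fun h : R => h^-1 *: ((f \o shift t) _ - f t))) //.
  apply: cvg_trans df; apply: cvg_app.
  move=> A [e egt0 Ae]; exists e => // x xe xgt0; apply: Ae => //.
  exact/ltr0_neq0.
near=> h.
have h0 : h < 0 by near: h; exists 1 => /=.
have : f t + k * h <= f (t + h) by near: h.
rewrite /= [_ *: 1]mulr1 [h + t]addrC [_ *: _]mulrC => fth.
by rewrite ler_ndivrMr// lerBrDl.
Unshelve. all: by end_near. Qed.

(** At the minimum [df] vanishes; if its derivative [l] were negative, [df] would
    be negative just to the right, and the mean value theorem would give a
    smaller value of [f] there.  The derivative is an explicit function [df],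
    differentiated at [c] alone, so that it can be a partial derivative
    restricted to a line, known only inside an open set. *)
Lemma second_derivative_ge0_at_min (R : realType) (f df : R -> R) (a b c l : R) :
  c \in `]a, b[%R ->
  (forall s, s \in `]a, b[%R -> is_derive s 1 f (df s)) ->
  is_derive c 1 df l ->
  (forall s, s \in `]a, b[%R -> f c <= f s) -> 0 <= l.
Proof.
move=> cab fdf [dfd dfl] fmin.
have ab : a < b by move: cab; rewrite in_itv/= => /andP[]; exact: lt_trans.
have dfc : df c = 0.
  have /@derive_val := derive1_at_min (ltW ab) (fun s h => @ex_derive _ _ _ _ _ _ _ (fdf s h)) cab fmin.
  by rewrite (@derive_val _ _ _ _ _ _ _ (fdf c cab)).
rewrite leNgt; apply/negP => l0.
have : \forall h \near 0^'+, df (c + h) < 0.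
  have qlt : \forall h \near 0^', h^-1 *: ((df \o shift c) (h *: 1) - df c) < 0.
    by apply: (cvgr_lt l) => //; rewrite -dfl; exact: dfd.
  have {}qlt : \forall h \near 0^'+, h^-1 *: ((df \o shift c) (h *: 1) - df c) < 0.
    case: qlt => e /= e0 He; exists e => //= h he h0; apply: He => //.
    exact: lt0r_neq0.
  near=> h.
  have h0 : 0 < h by near: h; exists 1 => /=.
  have : h^-1 *: ((df \o shift c) (h *: 1) - df c) < 0 by near: h.
  by rewrite /= dfc subr0 [_ *: 1]mulr1 [h + c]addrC [_ *: _]mulrC pmulr_llt0// invr_gt0.
case=> e /= e0 dflt.
move: cab; rewrite in_itv/= => /andP[ac cb].
(* Halving [e] and [b - c] keeps all of [c, d] inside the neighbourhood of [c]
   where [df] is negative and inside ]a, b[. *)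
pose d := c + minr (e / 2) ((b - c) / 2).
have cd : c < d by rewrite ltrDl lt_min !divr_gt0// subr_gt0.
have db : d < b.
  rewrite /d -ltrBrDl gt_min; apply/orP; right.
  by rewrite ltr_pdivrMr// mulr2n; lra.
have de : d < c + e.
  rewrite /d ltrD2l gt_min; apply/orP; left.
  by rewrite ltr_pdivrMr// mulr2n; lra.
clearbody d.
have sab s : s \in `[c, d]%R -> s \in `]a, b[%R.
  by rewrite !in_itv/= => /andP[cs sd]; rewrite (lt_le_trans ac)// (le_lt_trans sd).
have scd s : s \in `]c, d[%R -> s \in `]a, b[%R.
  by move=> scd; apply: sab; move: scd; rewrite !in_itv/= => /andP[/ltW -> /ltW ->].
have fcont : {within `[c, d], continuous f}.
  apply: derivable_within_continuous => s /sab sI.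
  exact: (@ex_derive _ _ _ _ _ _ _ (fdf s sI)).
have [s {}scd fdc] := MVT cd (fun s h => fdf s (scd s h)) fcont.
have : f c <= f d by apply/fmin/sab; rewrite in_itv/= lexx ltW.
rewrite -subr_ge0 fdc leNgt => /negP; apply.
rewrite nmulr_rlt0 ?subr_gt0//.
move: scd; rewrite in_itv/= => /andP[cs sd].
have -> : s = c + (s - c) by rewrite addrC subrK.
apply: dflt; rewrite /= ?subr_gt0// sub0r normrN gtr0_norm ?subr_gt0//.
by lra.
Unshelve. all: by end_near. Qed.

Lemma is_derive_line (R : realType) (V : normedModType R) (f : V -> R)
    (x v : V) (s : R) :
  derivable f (x + s *: v) v ->
  is_derive s 1 (fun r => f (x + r *: v)) ('D_v f (x + s *: v)).
Proof.
have quotE : (fun h : R =>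
      h^-1 *: (((fun r => f (x + r *: v)) \o shift s) (h *: 1) - f (x + s *: v))) =
    (fun h : R => h^-1 *: ((f \o shift (x + s *: v)) (h *: v) - f (x + s *: v))).
  apply/funext => h /=; congr (_ *: (f _ - _)).
  by rewrite [_ *: 1]mulr1 scalerDl addrCA.
by move=> fD; split; rewrite /derivable /derive quotE.
Qed.

Lemma enorm2_line (R : realType) (n : nat) (x : 'rV[R]_n) (i : 'I_n) (s : R) :
  enorm (x + s *: delta_mx ord0 i) ^+ 2 =
  enorm x ^+ 2 + (2 * x ord0 i * s + s ^+ 2).
Proof.
rewrite !enormE2 (bigD1 i)//= [in RHS](bigD1 i)//= !mxE !eqxx mulr1.
rewrite (eq_bigr (fun j => x ord0 j ^+ 2)); first by ring.
by move=> j /negPf ji; rewrite !mxE ji andbF mulr0 addr0.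
Qed.

(** The comparison function of the theorem is, at each time, a paraboloid in the
    space variable.  On a line parallel to a coordinate axis, [f] minus the
    paraboloid has a minimum at [x], so each pure second derivative of [f] is at
    least the one of the paraboloid, [2 * k]; these add up to [2 * n%:R * k]. *)
Lemma laplacian_ge_touching_paraboloid (R : realType) (n : nat) (f : 'rV[R]_n -> R)
    (D : set 'rV[R]_n) (x : 'rV[R]_n) (k : R) :
  open D -> D x -> C2_on D f ->
  (forall z, D z -> f x + k * (enorm z ^+ 2 - enorm x ^+ 2) <= f z) ->
  2 * n%:R * k <= laplacian f x.
Proof.
move=> oD Dx fC2 ftouch.
suff pk i : 2 * k <= partial i (partial i f) x.
  rewrite /laplacian (le_trans _ (ler_sum _ (fun i _ => pk i)))//.
  by rewrite sumr_const card_ord -mulr_natl; lra.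
pose e : 'rV[R]_n := delta_mx ord0 i.
have line0 : x + (0 : R) *: e = x by rewrite scale0r addr0.
have [d d0 lineD] : exists2 d : R, 0 < d &
    forall s, s \in `](- d), d[%R -> D (x + s *: e).
  have : \forall s \near (0 : R), D (x + s *: e).
    have ce : {for 0, continuous (fun s : R => x + s *: e)}.
      by apply: cvgD; [exact: cvg_cst|apply: cvgZl; exact: cvg_id].
    by apply: ce; rewrite line0; apply: open_nbhs_nbhs; split.
  case=> d /= d0 dD; exists d => // s; rewrite in_itv/= => sd; apply: dD.
  by rewrite /= sub0r normrN ltr_norml.
pose df (s : R) := partial i f (x + s *: e) - k * (2 * x ord0 i + 2 * s).
have q (s : R) : is_derive s 1 (fun r : R => k * (2 * x ord0 i * r + r ^+ 2))
    (k * (2 * x ord0 i + 2 * s)).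
  by apply: is_derive_eq; rewrite /GRing.scale/=; ring.
have dq (s : R) : is_derive s 1 (fun r : R => k * (2 * x ord0 i + 2 * r)) (k * 2).
  by apply: is_derive_eq; rewrite /GRing.scale/=; ring.
(* Along the line, [enorm z ^+ 2 - enorm x ^+ 2] is the polynomial
   [2 * x ord0 i * s + s ^+ 2] differentiated in [q] and [dq]. *)
suff : 0 <= partial i (partial i f) x - k * 2 by rewrite subr_ge0 mulrC.
apply: (@second_derivative_ge0_at_min R
  (fun s => f (x + s *: e) - k * (2 * x ord0 i * s + s ^+ 2)) df (- d) d 0).
- by rewrite in_itv/= oppr_lt0 d0.
- move=> s sd; have [dfi _ _] := fC2 _ (lineD _ sd) i.
  exact: (is_deriveB (is_derive_line dfi) (q s)).
- have [_ _ /(_ i)[dffi _]] := fC2 _ Dx i.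
  rewrite -[in partial i (partial i f) x]line0; rewrite -line0 in dffi.
  exact: (is_deriveB (is_derive_line dffi) (dq 0)).
- move=> s sd; rewrite line0; have := ftouch _ (lineD _ sd).
  by rewrite enorm2_line; lra.
Qed.

(** Weak minimum principle for supersolutions of the heat equation, tested
    against the barrier [v x t = Tb - (b - a * t) * (1 - |x|^2)].  Its time
    derivative is [a * (1 - |x|^2) <= a] and its Laplacian is
    [2 * n%:R * (b - a * t)], so the third hypothesis makes it a subsolution.
    The minimum of [u - v + e * t] over the compact cylinder is either on the
    parabolic boundary, where the data give the sign, or at some [(x0, t0)] with
    [x0] inside and [t0 > 0]; there the time derivative of [u] is at most
    [a - e], while [c] times its Laplacian is at least [a], contradicting the
    inequality satisfied by [u]. *)
Lemma paraboloid_barrier_le (R : realType) (n : nat) (c Tb a b T : R)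
    (u : 'rV[R]_n -> R -> R) :
  0 < c -> 0 <= a ->
  (forall t, 0 < t <= T -> a <= 2 * n%:R * c * (b - a * t)) ->
  classical u ->
  (forall x t, unit_ball R n x -> 0 < t <= T ->
     c * laplacian (fun z => u z t) x <= derive1 (u x) t) ->
  (forall x t, unit_sphere R n x -> 0 <= t <= T -> Tb <= u x t) ->
  (forall x, unit_ball R n x -> Tb - b * (1 - enorm x ^+ 2) <= u x 0) ->
  forall x t, unit_cball R n x -> 0 <= t <= T ->
    Tb - (b - a * t) * (1 - enorm x ^+ 2) <= u x t.
Proof.
move=> c0 a0 abT [ucont uC1 uC2] ueq ubdry uinit.
pose v (x : 'rV[R]_n) (t : R) := Tb - (b - a * t) * (1 - enorm x ^+ 2).
(* The term [e * t] turns the weak differential inequality into a strict one;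
   [e] then tends to 0. *)
suff vu_eps (e : R) : 0 < e -> forall x t, unit_cball R n x -> 0 <= t <= T ->
    v x t <= u x t + e * t.
  move=> x t xB tT; apply/ler_addgt0Pr => e e0.
  have /andP[t0 _] := tT.
  have t1 : 0 < t + 1 by rewrite ltr_wpDl.
  rewrite (le_trans (vu_eps (e / (t + 1)) _ x t xB tT)) ?divr_gt0//.
  by rewrite lerD2l mulrAC ler_pdivrMr// ler_pM2l// lerDl.
move=> e0 x1 t1 x1B t1T.
pose A := unit_cball R n `*` `[0, T].
pose g (p : 'rV[R]_n * R) := u p.1 p.2 - (v p.1 p.2 - e * p.2).
have vcont : continuous (fun p : 'rV[R]_n * R => v p.1 p.2 - e * p.2).
  move=> p; have c1 : enorm q.1 @[q --> p] --> enorm p.1.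
    by apply: continuous_comp; [exact: cvg_fst|exact: enorm_continuous].
  have c2 : q.2 @[q --> p] --> p.2 by exact: cvg_snd.
  have cc (r : R) : (fun=> r) @ p --> r by exact: cvg_cst.
  rewrite /v /continuous_at; apply: cvgB; last exact: cvgM.
  apply: cvgB => //; apply: cvgM.
    by apply: cvgB => //; exact: cvgM.
  by apply: cvgB => //; rewrite expr2; exact: cvgM.
have gcont : {within A, continuous g}.
  have ucontA : {within A, continuous (fun p : 'rV[R]_n * R => u p.1 p.2)}.
    apply: continuous_subspaceW ucont => -[x t] [/= xB tT]; split => //=.
    by move: tT; rewrite !in_itv/= andbT => /andP[].
  by move=> p; apply: cvgB;
    [exact: ucontA|exact: (continuous_subspaceT vcont)].
have cA : compact A.
  by apply: compact_setX; [exact: unit_cball_compact|exact: segment_compact].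
have A0 : A !=set0 by exists (x1, t1); split => //=; rewrite in_itv.
have [[x0 t0]] := compact_EVT_min A0 cA gcont.
rewrite inE => -[/= x0B]; rewrite in_itv/= => t0T gmin.
have {}gmin x t : unit_cball R n x -> 0 <= t <= T -> g (x0, t0) <= g (x, t).
  by move=> xB tT; apply: gmin; rewrite inE; split => //=; rewrite in_itv.
suff g0 : 0 <= g (x0, t0).
  by have := le_trans g0 (gmin _ _ x1B t1T); rewrite /g/=; lra.
have [t0_ge0 t0_leT] := andP t0T.
have [x0S|/eqP x0S] := eqVneq (enorm x0) 1.
  rewrite /g /v/= x0S; have := ubdry _ _ x0S t0T.
  by have := mulr_ge0 (ltW e0) t0_ge0; lra.
have {x0S}x0b : unit_ball R n x0 by rewrite /unit_ball/= lt_neqAle x0B andbT; apply/eqP.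
have [t00|t0N] := eqVneq t0 0.
  by rewrite /g /v/= t00; have := uinit _ x0b; lra.
have t0_gt0 : 0 < t0 by rewrite lt_neqAle eq_sym t0N.
have t0T' : 0 < t0 <= T by rewrite t0_gt0.
have lapl : 2 * n%:R * (b - a * t0) <= laplacian (fun z => u z t0) x0.
  apply: laplacian_ge_touching_paraboloid (uC2 _ t0_gt0) _ => //; first exact: unit_ball_open.
  by move=> z zb; have := gmin z t0 (ltW zb) t0T; rewrite /g /v/=; lra.
have dt : derive1 (u x0) t0 <= a * (1 - enorm x0 ^+ 2) - e.
  apply: derive1_le_left.
    by have [] := uC1 _ x0b t0; rewrite /= ?in_itv/= ?andbT.
  exists t0 => //= h; rewrite /ball_/= sub0r normrN => ht h0.
  have : 0 <= t0 + h <= T.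
    move: ht; rewrite ltr0_norm//; lra.
  by move=> /(gmin _ _ x0B); rewrite /g /v/=; lra.
have := abT _ t0T'; have := ueq _ _ x0b t0T'.
have : c * (2 * n%:R * (b - a * t0)) <= c * laplacian (fun z => u z t0) x0.
  by rewrite ler_pM2l.
have : 0 <= a * enorm x0 ^+ 2 by rewrite mulr_ge0// sqr_ge0.
lra.
Qed.

Theorem theorem2p5 (R : realType) (n : nat) (c Theta Theta_bar beta : R)
    (K : 'rV[R]_n -> 'rV[R]_n -> R) (u : 'rV[R]_n -> R -> R)
    (n_gt0 : (0 < n)%N) (c_gt0 : 0 < c)
    (K_adm : admissible_kernel K)
    (Theta_lt : Theta < Theta_bar)
    (beta_gt : Theta_bar - Theta < beta) :
  let alpha := 2 * n%:R * c * (Theta_bar - Theta) in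
  let t_star := (beta - Theta_bar + Theta) / alpha in
  forall
    (u_classical : classical u)
    (u_eq : forall (x : 'rV[R]_n) (t : R), unit_ball R n x -> 0 < t ->
      ((derive1 (u x) t)%:E =
       (c * laplacian (fun z => u z t) x)%:E +
       \int[lebesgue R n]_(y in unit_ball R n)
          (Num.max (u y t - Theta) 0 * K x y)%:E)%E)
    (u_bdry : forall (x : 'rV[R]_n) (t : R), unit_sphere R n x -> 0 <= t -> u x t = Theta_bar)
    (u_init : forall x : 'rV[R]_n, unit_ball R n x ->
      Theta_bar - beta * (1 - enorm x ^+ 2) <= u x 0),
  (forall x : 'rV[R]_n, unit_ball R n x -> Theta <= u x t_star) /\
  (forall (x : 'rV[R]_n) (t : R), unit_ball R n x -> 0 <= t <= t_star ->
     Theta_bar - (beta - alpha * t) * (1 - enorm x ^+ 2) <= u x t).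
Proof.
move=> alpha t_star u_classical u_eq u_bdry u_init.
have n2c : 0 < 2 * n%:R * c by rewrite !mulr_gt0// ltr0n.
have alpha_gt0 : 0 < alpha by rewrite mulr_gt0// subr_gt0.
have alphaM_star : alpha * t_star = beta - Theta_bar + Theta.
  by rewrite mulrC divfK// gt_eqF.
have t_star_ge0 : 0 <= t_star by rewrite divr_ge0// ?ltW//; lra.
(* Up to [t_star], [beta - alpha * s >= Theta_bar - Theta]: this is where the
   value of [alpha] makes the barrier a subsolution. *)
have barrier (x : 'rV[R]_n) (t : R) : unit_ball R n x -> 0 <= t <= t_star ->
    Theta_bar - (beta - alpha * t) * (1 - enorm x ^+ 2) <= u x t.
  move=> xb; apply: paraboloid_barrier_le c_gt0 (ltW alpha_gt0) _ u_classical _ _ u_init _ _ (ltW xb).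
  - move=> s /andP[_ s_le]; rewrite {1}/alpha ler_pM2l//.
    have : alpha * s <= alpha * t_star by rewrite ler_pM2l.
    by rewrite alphaM_star; lra.
  (* The nonlocal term is the integral of a nonnegative function. *)
  - move=> y s yb /andP[s0 _]; rewrite -lee_fin u_eq// leeDl//.
    apply: integral_ge0 => z zb; rewrite lee_fin mulr_ge0//.
      by rewrite le_max lexx orbT.
    by case: K_adm => K0 _ _ _; exact: K0.
  - by move=> y s yS /andP[s0 _]; rewrite u_bdry.
split=> // x xb; apply: le_trans (barrier x t_star xb _).
  rewrite alphaM_star.
  have : 0 <= (Theta_bar - Theta) * enorm x ^+ 2.
    by rewrite mulr_ge0 ?sqr_ge0// subr_ge0 ltW.
  by lra.
by rewrite lexx andbT.
Qed.
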